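(* Let $(S_n)_{n\ge 0}$ be the minimal random walk with parameters $p,q,s\in[0,1]$, and let $a=p-q$. Assume $a>1/2$ (superdiffusive regime). Then, as $n\to\infty$, we have the almost sure convergence $$\left(n^{1-a}\Big(\frac{S_{\lfloor nt\rfloor}}{\lfloor nt\rfloor}-\frac{q}{1-a}\Big),\ t>0\right)\longrightarrow\Big(\frac{1}{t^{1-a}}L,\ t>0\Big),$$ where $L$ is a non-degenerate random variable. In particular, $$\lim_{n\to\infty} n^{1-a}\Big(\frac{S_n}{n}-\frac{q}{1-a}\Big)=L\qquad\text{a.s.}$$ Moreover, this convergence also holds in $L^2$: $$\lim_{n\to\infty}\mathbb E\Big[\Big(n^{1-a}\Big(\frac{S_n}{n}-\frac{q}{1-a}\Big)-L\Big)^2\Big]=0 .$$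
   Context: Minimal random walk (MRW) with parameters $p,q,s\in[0,1]$: $S_0=0$, $S_1=X_1$ where $X_1$ has the Bernoulli distribution with success probability $s$. For every $n\ge1$, $$X_{n+1}=\alpha_{n+1}X_{U_n}+\beta_{n+1}(1-X_{U_n}),\qquad S_{n+1}=S_n+X_{n+1},$$ where $\alpha_{n+1}\sim$ Bernoulli$(p)$, $\beta_{n+1}\sim$ Bernoulli$(q)$, $U_n$ is uniform on $\{1,\dots,n\}$, and $\alpha_{n+1},\beta_{n+1},U_n$ are mutually independent and independent of $(X_1,\dots,X_n)$. Standing assumption: $a=p-q<1$, i.e. $(p,q)\ne(1,0)$.
   Formalization: Non-degeneracy of L is claimed only when (s,q) is not (0,0) and (s,p) is not (1,1): in those two cases S_n = 0 a.s. or S_n = n a.s., so L = 0 is constant; all convergence claims are kept for all p, q, s. *)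

(* Defs.v *)
From HB Require Import structures.
From mathcomp Require Import all_boot all_order all_algebra finmap.
From mathcomp Require Import all_classical all_reals all_analysis.

Set Implicit Arguments.
Unset Strict Implicit.
Unset Printing Implicit Defensive.

Import Order.TTheory GRing.Theory Num.Theory.
Import numFieldNormedType.Exports.

Local Open Scope classical_set_scope.
Local Open Scope ring_scope.

Definition mutually_independent (d : measure_display) (T : measurableType d)
    (R : realType) (P : probability T R) (I : choiceType)
    (F : I -> set_system T) : Prop :=
  forall (J : {fset I}) (E : I -> set T),
    (forall i, i \in J -> F i (E i)) ->
    P (\bigcap_(i in [set` J]) E i) = (\prod_(i <- J) P (E i))%E.

Definition sigma_upto (d d' : measure_display) (T : measurableType d)
    (T' : measurableType d') (X : nat -> T -> T') (n : nat) : set_system T :=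
  <<s \bigcup_(i in [set i | (1 <= i <= n)%N]) g_sigma_algebra_preimage (X i) >>.

(* Bernoulli variables are bool-valued, with law [bernoulli_prob], and are read
   as 0/1-valued real variables through [%:R].
   The steps are X 1, X 2, ...; X 0 plays no role. *)
Record minimal_random_walk (d : measure_display) (T : measurableType d)
    (R : realType) (P : probability T R) (p q s : R)
    (X alpha beta : nat -> {RV P >-> bool}) (U : nat -> {RV P >-> nat})
    (S : nat -> T -> R) : Prop := MinimalRandomWalk {
  mrw_X1 : distribution P (X 1%N) =1 bernoulli_prob s;
  mrw_alpha : forall n, (1 <= n)%N ->
    distribution P (alpha n.+1) =1 bernoulli_prob p;
  mrw_beta : forall n, (1 <= n)%N ->
    distribution P (beta n.+1) =1 bernoulli_prob q;
  mrw_U : forall n k, (1 <= k <= n)%N ->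
    P [set w | U n w = k] = (n%:R^-1)%:E;
  mrw_independent : forall n, (1 <= n)%N ->
    mutually_independent P
      (tnth [tuple g_sigma_algebra_preimage (alpha n.+1);
                   g_sigma_algebra_preimage (beta n.+1);
                   g_sigma_algebra_preimage (U n);
                   sigma_upto (fun i => X i : T -> bool) n]);
  mrw_step : forall n w, (1 <= n)%N ->
    (X n.+1 w)%:R = (alpha n.+1 w)%:R * (X (U n w) w)%:R
                    + (beta n.+1 w)%:R * (1 - (X (U n w) w)%:R) :> R;
  mrw_S0 : forall w, S 0%N w = 0;
  mrw_S : forall n w, S n.+1 w = S n w + (X n.+1 w)%:R }.

Definition nondegenerate_RV (d : measure_display) (T : measurableType d)
    (R : realType) (P : probability T R) (L : T -> R) : Prop :=
  ~ exists c : R, {ae P, forall w, L w = c}.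

(* Main.v *)
(* With b = q / (1 - a), the process M n = (S n - n b) / A n, where A n is the
   product of the (1 + a / k) for 1 <= k < n, is a martingale whose increments are
   bounded by 1 / A (n + 1).  The sum of the squares 1 / A k ^ 2 converges
   exactly because a > 1/2: it telescopes against n / ((2 a - 1) A n ^ 2).
   Hence M is Cauchy in L^2 and, by a maximal inequality, almost surely.
   By Bernoulli's inequality A n / n ^ a is nondecreasing and bounded, so that
   n ^ (1 - a) (S n / n - b) = (A n / n ^ a) M n converges as well; Fatou's lemma
   identifies the L^2 limit.  The limit is not constant because the variance of M
   is nondecreasing and already positive at time 2.  Convergence on compact
   sets of times is a deterministic consequence of the convergence at integer times. *)
Require Import Defs.
From HB Require Import structures.
From mathcomp Require Import all_boot all_order all_algebra finmap.
From mathcomp Require Import all_classical all_reals all_analysis.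
From mathcomp Require Import measurable_realfun ring lra.

Set Implicit Arguments.
Unset Strict Implicit.
Unset Printing Implicit Defensive.

Import Order.TTheory GRing.Theory Num.Theory.
Import numFieldNormedType.Exports.

Local Open Scope classical_set_scope.
Local Open Scope ring_scope.

(** * The normalizing product *)

(** Bernoulli's inequality for concave powers. It is Young's inequality for the product of the
    [a]-th power of [1 + x] and 1, with conjugate exponents [a^-1] and [(1 - a)^-1]. *)
Lemma powR_le1Dx (R : realType) (x a : R) : 0 < a < 1 -> 0 <= 1 + x ->
  (1 + x) `^ a <= 1 + a * x.
Proof.
move=> /andP[a0 a1] x0.
have a1' : 0 < 1 - a by rewrite subr_gt0.
have := @conjugate_powR R ((1 + x) `^ a) 1 a^-1 (1 - a)^-1 (powR_ge0 _ _) ler01.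
rewrite !invr_gt0 !invrK => /(_ a0 a1' (subrKC _ _)).
rewrite mulr1 -powRrM divff ?gt_eqF// powRr1// powR1 mul1r => /le_trans; apply.
by rewrite le_eqVlt; apply/orP; left; apply/eqP; ring.
Qed.

Section growth.
Variables (R : realType) (a : R).
Hypotheses (a_gt12 : 1 / 2 < a) (a_lt1 : a < 1).

(* The factor of index 0 is 1, because [a / 0 = 0]. *)
Definition growth (n : nat) : R := \prod_(k < n) (1 + a / k%:R).

Let a_gt0 : 0 < a. Proof. by apply: lt_trans a_gt12; rewrite divr_gt0. Qed.

Lemma growthS n : growth n.+1 = growth n * (1 + a / n%:R).
Proof. by rewrite /growth big_ord_recr. Qed.

Lemma growth1 : growth 1 = 1.
Proof. by rewrite growthS /growth big_ord0 invr0 mulr0 addr0 mul1r. Qed.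

Lemma growth_gt0 n : 0 < growth n.
Proof.
by apply: prodr_gt0 => k _; rewrite ltr_pwDl// divr_ge0// ltW.
Qed.

Definition growth_ratio (n : nat) : R := growth n / n%:R `^ a.

Lemma growth_ratio1 : growth_ratio 1 = 1.
Proof. by rewrite /growth_ratio growth1 powR1 divr1. Qed.

(** Going from n to n + 1 multiplies the ratio by (1 + a / n) / (1 + 1 / n)^a, which is at least 1
    by [powR_le1Dx]. *)
Lemma growth_ratio_nondecreasing n : (0 < n)%N ->
  growth_ratio n <= growth_ratio n.+1.
Proof.
move=> n0; have n0R : 0 < n%:R :> R by rewrite ltr0n.
rewrite /growth_ratio growthS.
have -> : n.+1%:R = n%:R * (1 + 1 / n%:R) :> R.
  by rewrite mulrDr mulr1 mulrCA divff ?gt_eqF// mulr1 natr1.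
have n1R : 0 < 1 + 1 / n%:R :> R by rewrite addr_gt0 ?divr_gt0.
rewrite powRM ?(ltW n0R) ?(ltW n1R)//.
rewrite ler_pdivlMr ?mulr_gt0 ?powR_gt0//.
rewrite mulrA divfK ?gt_eqF ?powR_gt0// ler_pM2l ?growth_gt0//.
rewrite (le_trans (powR_le1Dx _ _)) ?a_gt0 ?(ltW n1R)//.
by rewrite mulrA mulr1.
Qed.

Lemma growth_ratio_ge1 n : (0 < n)%N -> 1 <= growth_ratio n.
Proof.
elim: n => // -[_ _|n IHn _]; first by rewrite growth_ratio1.
by rewrite (le_trans (IHn _))// growth_ratio_nondecreasing.
Qed.

(* [growth_ratio n * (1 + 1 / n)] is nonincreasing. *)
Lemma growth_ratio_le2 n : (0 < n)%N -> growth_ratio n <= 2.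
Proof.
move=> n0; suff : growth_ratio n * (1 + n%:R^-1) <= 2.
  apply: le_trans; rewrite ler_peMr ?lerDl ?invr_ge0//.
  by rewrite (le_trans _ (growth_ratio_ge1 n0)).
elim: n n0 => // -[_ _|n IHn _].
  by rewrite growth_ratio1 invr1 mul1r.
apply: le_trans (IHn isT).
rewrite /growth_ratio growthS.
set x : R := n.+1%:R; have x0 : 0 < x by rewrite ltr0n.
have xS : n.+2%:R = x + 1 by rewrite natr1.
have x1 : 0 < x + 1 by rewrite addr_gt0.
rewrite xS.
(* [powR_le1Dx] at [- (x + 1)^-1], since [x = (x + 1) * (1 - (x + 1)^-1)]. *)
have B : x `^ a <= (x + 1) `^ a * (1 - a / (x + 1)).
  have -> : x `^ a = (x + 1) `^ a * (1 + - (x + 1)^-1) `^ a.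
    rewrite -powRM ?(ltW x1)//; first by congr (_ `^ _); field; rewrite gt_eqF.
    by rewrite subr_ge0 invf_le1// lerDr ltW.
  rewrite ler_pM2l ?powR_gt0// (le_trans (powR_le1Dx _ _)) ?a_gt0//.
    by rewrite subr_ge0 invf_le1// lerDr ltW.
  by rewrite mulrN.
have y0 : 0 < (x + 1) `^ a by exact: powR_gt0.
have z0 : 0 < x `^ a by exact: powR_gt0.
move: ((x + 1) `^ a) (x `^ a) B y0 z0 => y z B y0 z0.
have le_yz : (1 + a / x) * (1 + (x + 1)^-1) * z <= (1 + x^-1) * y.
  have c0 : 0 <= (1 + a / x) * (1 + (x + 1)^-1).
    by rewrite mulr_ge0 ?addr_ge0 ?divr_ge0 ?invr_ge0 ?ltW.
  apply: le_trans (ler_wpM2l c0 B) _.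
  rewrite mulrCA [leRHS]mulrC ler_pM2l// -subr_ge0.
  (* The numerator on the right is at least [x / 2], because [a * (1 - a) <= 1 / 2]. *)
  have -> : 1 + x^-1 - (1 + a / x) * (1 + (x + 1)^-1) * (1 - a / (x + 1)) =
      (x + 1 - a * (1 - a) * (x + 2)) / (x * (x + 1) ^+ 2).
    by field; rewrite !gt_eqF.
  rewrite divr_ge0 ?mulr_ge0 ?exprn_ge0 ?ltW//.
  have : a * (1 - a) <= 1 / 2 by nra.
  by nra.
have g0 := growth_gt0 n.+1.
have -> : growth n.+1 * (1 + a / x) / y * (1 + (x + 1)^-1) =
    growth n.+1 / (y * z) * ((1 + a / x) * (1 + (x + 1)^-1) * z).
  by field; rewrite !gt_eqF.
have -> : growth n.+1 / z * (1 + x^-1) =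
    growth n.+1 / (y * z) * ((1 + x^-1) * y).
  by field; rewrite !gt_eqF.
by rewrite ler_pM2l// divr_gt0// mulr_gt0.
Qed.

Lemma is_cvg_growth_ratio : cvgn growth_ratio.
Proof.
have : cvgn (fun n => growth_ratio n.+1).
  apply: nondecreasing_is_cvgn.
    by apply/nondecreasing_seqP => n; exact: growth_ratio_nondecreasing.
  by exists 2 => _ [n _ <-]; exact: growth_ratio_le2.
by move=> /cvg_ex[l]; rewrite cvg_shiftS => cl; apply/cvg_ex; exists l.
Qed.

Lemma growth_ratio_le m n : (0 < m)%N -> (m <= n)%N ->
  growth_ratio m <= growth_ratio n.
Proof.
move=> m0 mn; rewrite -(subnKC mn); elim: (n - m)%N => [|k IHk].
  by rewrite addn0.
by rewrite (le_trans IHk)// addnS growth_ratio_nondecreasing// addn_gt0 m0.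
Qed.

Lemma growth_ratio_le_lim m : (0 < m)%N -> growth_ratio m <= limn growth_ratio.
Proof.
move=> m0; apply: limr_ge; first exact: is_cvg_growth_ratio.
by exists m => // n /= mn; exact: growth_ratio_le.
Qed.

(* A closed-form majorant of the sum of [1 / growth k ^+ 2] over [k > n]. *)
Definition tail_bound (n : nat) : R := n%:R / ((2 * a - 1) * growth n ^+ 2).

Let a21_gt0 : 0 < 2 * a - 1.
Proof. by move: a_gt12; lra. Qed.

(** The slack is an explicit nonnegative fraction: over a common denominator the terms in n^3 and
    n^2 cancel, thanks to the constant [2 * a - 1], and only [a ^+ 2] times n is left. *)
Lemma tail_bound_step n : (0 < n)%N ->
  (growth n.+1 ^+ 2)^-1 <= tail_bound n - tail_bound n.+1.
Proof.
move=> n0; rewrite /tail_bound growthS -(natr1 n).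
have g0 := growth_gt0 n; move: (growth n) g0 => g g0.
have : 0 < n%:R :> R by rewrite ltr0n.
move: (n%:R : R) => x x0.
have xa0 : 0 < x + a by rewrite addr_gt0.
rewrite -subr_ge0.
have -> : x / ((2 * a - 1) * g ^+ 2)
    - (x + 1) / ((2 * a - 1) * (g * (1 + a / x)) ^+ 2)
    - ((g * (1 + a / x)) ^+ 2)^-1
  = a ^+ 2 * x / ((2 * a - 1) * g ^+ 2 * (x + a) ^+ 2).
  by field; rewrite !gt_eqF.
by rewrite divr_ge0 ?mulr_ge0 ?exprn_ge0 ?ltW.
Qed.

Lemma tail_bound_ge0 n : 0 <= tail_bound n.
Proof. by rewrite divr_ge0// mulr_ge0 ?exprn_ge0 ?ltW ?growth_gt0. Qed.

Lemma cvg_tail_bound : tail_bound n @[n --> \oo] --> 0.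
Proof.
rewrite -cvg_shiftS/=.
(* Since [growth n.+1] is at least (n + 1)^a, [tail_bound n.+1] is at most (n + 1)^(1 - 2a) / (2a -
   1), written here through [harmonic n], which is 1 / (n + 1). *)
have h : harmonic n `^ (2 * a - 1) / (2 * a - 1) @[n --> \oo] --> (0 : R).
  rewrite -[X in _ --> X](mul0r (2 * a - 1)^-1); apply: cvgMr_tmp.
  have /cvg_at_rightP/(_ harmonic) := powR_cvg0 a21_gt0; apply.
  by split => [n|]; [rewrite invr_gt0|exact: cvg_harmonic].
apply: (squeeze_cvgr _ (cvg_cst 0) h); apply: nearW => n.
rewrite tail_bound_ge0/= /tail_bound /harmonic.
have : n.+1%:R `^ a <= growth n.+1.
  have := @growth_ratio_ge1 n.+1 isT.
  by rewrite /growth_ratio ler_pdivlMr ?powR_gt0// mul1r.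
set x : R := n.+1%:R => xg; have x0 : 0 < x by rewrite ltr0n.
have xa0 : 0 < x `^ a by exact: powR_gt0.
have -> : x^-1 `^ (2 * a - 1) = x / (x `^ a) ^+ 2.
  rewrite -powR_inv1 ?(ltW x0)// -powRrM mulN1r opprB powRB; last first.
    by rewrite (gt_eqF x0) implybT.
  by rewrite powRr1 ?(ltW x0)// [2 * a]mulrC powRrM powR_mulrn ?(ltW xa0).
rewrite -mulrA -invfM ler_pM2l// lef_pV2 ?posrE ?mulr_gt0 ?exprn_gt0 ?growth_gt0//.
by rewrite mulrC ler_pM2l// lerXn2r ?nnegrE ?(ltW xa0) ?(ltW (growth_gt0 _)).
Qed.

End growth.

(** * From integer times to compact sets of times *)

Lemma compact_gt0_lbound (R : realType) (K : set R) :
  K `<=` `]0, +oo[ -> compact K ->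
  exists2 k0 : R, 0 < k0 & forall t, K t -> k0 <= t.
Proof.
move=> K0 cK; have [->|/set0P Kn0] := eqVneq K set0; first by exists 1.
have [|k] := compact_EVT_min Kn0 cK (f := id).
  by apply: continuous_subspaceT => x; exact: cvg_id.
rewrite inE => Kk kmin; exists k => [|t Kt].
  by have := K0 _ Kk; rewrite /= in_itv/= andbT.
by apply: kmin; rewrite inE.
Qed.

(** With m the integer part of nt and r = nt / m, the value at time t is t^(-g) r^g [y m]. As 1 <=
    r^g <= r <= 1 + 1 / m, the distance from r^g [y m] to [l] is at most [z m], and m is large
    uniformly over t in a compact set of positive times. *)
Lemma family_cvg_rescale (R : realType) (g : R) (S : nat -> R) (b l : R) :
  0 <= g <= 1 ->
  (n%:R `^ g * (S n / n%:R - b)) @[n --> \oo] --> l ->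
  {family compactly_in (`]0, +oo[ : set R),
     (fun (n : nat) (t : R) =>
        n%:R `^ g * (S (Num.truncn (n%:R * t)) / (Num.truncn (n%:R * t))%:R - b))
     @ \oo --> (fun t : R => 1 / t `^ g * l)}.
Proof.
move=> /andP[g0 g1]; set y := fun n : nat => n%:R `^ g * (S n / n%:R - b) => yl.
apply/fam_cvgP => K [K0 cK].
have [k0 k0_gt0 Kk0] := compact_gt0_lbound K0 cK.
pose z n := `|l - y n| + `|y n| * n%:R^-1.
have z0 : z n @[n --> \oo] --> (0 : R).
  rewrite -[X in _ --> X]addr0; apply: cvgD.
    rewrite -(normr0 R) -(subrr l); apply: cvg_norm.
    by apply: cvgB => //; exact: cvg_cst.
  rewrite -(mulr0 `|l|); apply: cvgM; first exact: cvg_norm.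
  rewrite -cvg_shiftS; exact: cvg_harmonic.
move=> W /uniform_nbhs[E [entE sW]].
move: entE; rewrite -entourage_from_ballE => -[e /= e0 EW].
have ke0 : 0 < e * k0 `^ g by rewrite mulr_gt0// powR_gt0.
have [N _ zN] := (cvgr_lt _ z0 _ ke0).
(* For [n >= N'] and [t >= k0] the product [n%:R * t] is at least [N.+1], so its integer part
   exceeds [N]. *)
pose N' := (Num.truncn (N.+1%:R / k0)).+1.
exists N' => // n /= Nn; apply: sW => t /= Kt; apply: EW.
rewrite /ball/= /ball_/=.
have kt := Kk0 _ Kt; have t0 : 0 < t by exact: lt_le_trans kt.
have Nnt : N.+1%:R <= n%:R * t.
  rewrite -ler_pdivrMr//.
  apply: (@le_trans _ _ (N.+1%:R / k0)); first by rewrite ler_pM2l// lef_pV2.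
  by apply/ltW/(lt_le_trans (truncnS_gt _)); rewrite ler_nat.
have n0 : 0 < n%:R :> R by rewrite ltr0n (leq_trans _ Nn).
have nt0 : 0 <= n%:R * t by rewrite mulr_ge0// ltW.
have /andP[mnt ntm] := truncn_itv nt0.
set m := Num.truncn _ in mnt ntm *.
have Nm : (N < m)%N by rewrite truncn_ge_nat.
have m0 : 0 < m%:R :> R by rewrite ltr0n (leq_trans _ Nm).
pose r := n%:R * t / m%:R.
have r1 : 1 <= r by rewrite ler_pdivlMr// mul1r.
have rm : r <= 1 + m%:R^-1.
  by rewrite ler_pdivrMr// mulrDl mul1r mulVf ?gt_eqF// natr1 ltW.
have rg1 : 1 <= r `^ g by rewrite -[leLHS](powRr0 r); apply: ler_powR.
have rgm : r `^ g <= 1 + m%:R^-1 by apply: le_trans rm; exact: ler1_powR.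
have -> : n%:R `^ g * (S m / m%:R - b) = (t `^ g)^-1 * (r `^ g * y m).
  rewrite -[y m]/(m%:R `^ g * (S m / m%:R - b)) !mulrA; congr (_ * _).
  rewrite -mulrA -powRM ?(le_trans ler01 r1) ?(ltW m0)//.
  rewrite /r divfK ?gt_eqF// powRM ?(ltW n0) ?(ltW t0)// mulrCA mulVf ?mulr1//.
  by rewrite gt_eqF// powR_gt0.
rewrite div1r -mulrBr normrM gtr0_norm ?invr_gt0 ?powR_gt0//.
rewrite mulrC ltr_pdivrMr ?powR_gt0//.
apply: (@lt_le_trans _ _ (e * k0 `^ g)); last first.
  by rewrite ler_pM2l// ge0_ler_powR ?nnegrE// ltW.
apply: le_lt_trans (zN m (ltnW Nm)).
have -> : l - r `^ g * y m = (l - y m) + (1 - r `^ g) * y m by ring.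
rewrite (le_trans (ler_normD _ _))// lerD2l normrM mulrC.
by rewrite ler_wpM2l// ler0_norm ?subr_le0// opprB lerBlDl.
Qed.

(** * Expectation of bounded and of adapted variables *)

Lemma limn_einf_le (R : realType) (u : (\bar R)^nat) (N : nat) (l : \bar R) :
  (forall m, (N <= m)%N -> (u m <= l)%E) -> (limn_einf u <= l)%E.
Proof.
move=> ul; rewrite limn_einf_lim; apply: lime_le; first exact: is_cvg_einfs.
apply: nearW => k; apply: le_trans (ul (maxn k N) (leq_maxr _ _)).
by apply: ereal_inf_lbound; exists (maxn k N) => //=; exact: leq_maxl.
Qed.

Section bounded_measurable.
Context d (T : measurableType d) (R : realType) (P : probability T R).
Implicit Types Z W : T -> R.

(** A class of integrable functions stable under sums and products, which settles the integrability
    of polynomial expressions in the walk. *)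
Definition bounded_measurable Z :=
  measurable_fun [set: T] Z /\ exists M : R, forall w, `|Z w| <= M.

Lemma bounded_measurable_integrable Z :
  bounded_measurable Z -> P.-integrable [set: T] (EFin \o Z).
Proof.
move=> [mZ [M ZM]]; apply: (@le_integrable _ _ _ _ _ measurableT _ (EFin \o cst M)).
- exact/measurable_EFinP.
- by move=> w _ /=; rewrite lee_fin (le_trans (ZM w))// ler_norm.
- exact: (finite_measure_integrable_cst P).
Qed.

Lemma bounded_measurable_cst (c : R) : bounded_measurable (fun=> c).
Proof. by split; [exact: measurable_cst|exists `|c|]. Qed.

Lemma bounded_measurableD Z W : bounded_measurable Z -> bounded_measurable W ->
  bounded_measurable (fun w => Z w + W w).
Proof.
move=> [mZ [M ZM]] [mW [N WN]]; split; first exact: measurable_funD.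
by exists (M + N) => w; rewrite (le_trans (ler_normD _ _))// lerD.
Qed.

Lemma bounded_measurableM Z W : bounded_measurable Z -> bounded_measurable W ->
  bounded_measurable (fun w => Z w * W w).
Proof.
move=> [mZ [M ZM]] [mW [N WN]]; split; first exact: measurable_funM.
by exists (M * N) => w; rewrite normrM ler_pM.
Qed.

Lemma bounded_measurable_sum (I : Type) (r : seq I) (Z : I -> T -> R) :
  (forall i, bounded_measurable (Z i)) ->
  bounded_measurable (fun w => \sum_(i <- r) Z i w).
Proof.
move=> bZ; elim: r => [|i r IHr].
  by under eq_fun do rewrite big_nil; exact: bounded_measurable_cst.
by under eq_fun do rewrite big_cons; exact: bounded_measurableD.
Qed.

Lemma bounded_measurable_indic (A : set T) :
  measurable A -> bounded_measurable (\1_A : T -> R).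
Proof.
move=> mA; split; first exact: measurable_indic.
by exists 1 => w; rewrite indicE; case: (_ \in _); rewrite ?normr1 ?normr0.
Qed.

Lemma RintegralT_cst (c : R) : \int[P]_w c = c.
Proof. by rewrite Rintegral_cst//= (probability_setT P) mulr1. Qed.

Lemma RintegralT_indic (A : set T) :
  measurable A -> \int[P]_w (\1_A w : R) = fine (P A).
Proof. by move=> mA; rewrite /Rintegral integral_indic// setIT. Qed.

Lemma RintegralT_sum (I : Type) (r : seq I) (Z : I -> T -> R) :
  (forall i, bounded_measurable (Z i)) ->
  \int[P]_w (\sum_(i <- r) Z i w) = \sum_(i <- r) \int[P]_w Z i w.
Proof.
move=> bZ; elim: r => [|i r IHr].
  by rewrite big_nil; under eq_Rintegral do rewrite big_nil; exact: RintegralT_cst.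
rewrite big_cons -IHr; under eq_Rintegral do rewrite big_cons.
rewrite RintegralD//; apply: bounded_measurable_integrable => //.
exact: bounded_measurable_sum.
Qed.

Lemma ae_eq_RintegralT Z W : bounded_measurable Z -> bounded_measurable W ->
  {ae P, forall w, Z w = W w} -> \int[P]_w Z w = \int[P]_w W w.
Proof.
move=> [mZ _] [mW _] ZW; congr fine; apply: ae_eq_integral => //.
- exact/measurable_EFinP.
- exact/measurable_EFinP.
- by apply: filterS ZW => w -> .
Qed.

End bounded_measurable.

Section adapted.
Context d (T : measurableType d) (R : realType) (P : probability T R).
Variable X : nat -> {RV P >-> bool}.

(* Measurability with respect to X 1, ..., X n: the past is a finite vector of
   booleans, so depending only on it is enough. *)
Definition adapted (n : nat) (V : Type) (Z : T -> V) :=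
  forall w w', (forall i, (1 <= i <= n)%N -> X i w = X i w') -> Z w = Z w'.

Definition history (n : nat) (w : T) : n.-tuple bool := [tuple X i.+1 w | i < n].

Lemma adapted_history n (Z : T -> R) : adapted n Z ->
  exists f : n.-tuple bool -> R, forall w, Z w = f (history n w).
Proof.
move=> aZ.
(* The value at a chosen point with history [x]; the default 0 is for vectors that no point
   realizes. *)
exists (fun x => if pselect (exists w, history n w = x) is left e
                 then Z (projT1 (cid e)) else 0) => w.
case: pselect => [e|]; last by case; exists w.
case: (cid e) => /= w' Hw'; apply: aZ => i /andP[i1 iN].
have iN' : (i.-1 < n)%N by rewrite prednK.
have := congr1 (fun t => tnth t (Ordinal iN')) Hw'.
by rewrite !tnth_mktuple/= prednK.
Qed.

Lemma sigma_upto_measurable n (E : set T) :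
  sigma_upto (fun i => X i : T -> bool) n E -> measurable E.
Proof.
apply: smallest_sub; first exact: sigma_algebra_measurable.
move=> A [i _] [B mB <-]; rewrite setTI.
exact: (measurable_funPTI (X i)).
Qed.

(** The atoms of the past belong to the sigma-algebra for which independence is assumed. *)
Lemma sigma_upto_history n (x : n.-tuple bool) :
  sigma_upto (fun i => X i : T -> bool) n [set w | history n w = x].
Proof.
set G := \bigcup_(i in [set i | (1 <= i <= n)%N])
  g_sigma_algebra_preimage (X i : T -> bool).
have -> : [set w | history n w = x] =
    \bigcap_(i in [set i | (i < n)%N]) (X i.+1 @^-1` [set nth false x i]).
  apply/seteqP; split=> [w /= <- i /= ltin|w /= Xx].
    by have := tnth_nth false (history n w) (Ordinal ltin); rewrite tnth_mktuple.
  apply: eq_from_tnth => i; rewrite tnth_mktuple (tnth_nth false).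
  exact: (Xx i (ltn_ord i)).
apply: (@bigcap_measurableType _ (g_sigma_algebraType G)) => i /= ltin.
apply: sub_sigma_algebra; exists i.+1 => //.
by exists [set nth false x i] => //; rewrite setTI.
Qed.

(** Decomposition over the finitely many atoms of the past. It turns integrals of adapted variables
    into finite sums of probabilities, where independence applies directly. *)
Lemma adapted_sum_indic n (Z : T -> R) : adapted n Z ->
  exists f : n.-tuple bool -> R, forall w,
    Z w = \sum_(x : n.-tuple bool) f x * \1_[set w | history n w = x] w.
Proof.
move=> /adapted_history[f Zf]; exists f => w.
rewrite Zf (bigD1 (history n w))//= indicE mem_set// mulr1.
rewrite big1 ?addr0// => x /eqP xw; rewrite indicE memNset ?mulr0//= => wx.
exact: xw.
Qed.

Lemma measurable_history n (x : n.-tuple bool) :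
  measurable [set w | history n w = x].
Proof. by apply: sigma_upto_measurable; exact: sigma_upto_history. Qed.

Lemma adapted_bounded_measurable n (Z : T -> R) :
  adapted n Z -> bounded_measurable Z.
Proof.
move=> /adapted_sum_indic[f Zf]; rewrite (funext Zf).
apply: bounded_measurable_sum => x; apply: bounded_measurableM.
  exact: bounded_measurable_cst.
by apply: bounded_measurable_indic; exact: measurable_history.
Qed.

End adapted.

(** * The walk *)

Lemma mutually_independent_ord (d : measure_display) (T : measurableType d)
    (R : realType) (P : probability T R) (n : nat)
    (F : 'I_n -> set_system T) (E : 'I_n -> set T) :
  mutually_independent P F -> (forall i, F i (E i)) ->
  P (\bigcap_(i in [set: 'I_n]) E i) = (\prod_(i < n) P (E i))%E.
Proof.
move=> indF FE; pose J : {fset 'I_n} := [fset x in enum 'I_n]%fset.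
have JT i : i \in J by rewrite !inE mem_enum.
have -> : [set: 'I_n] = [set` J] by apply/seteqP; split=> i _ /=; rewrite ?JT.

rewrite (indF J E (fun i _ => FE i)) -[RHS]big_enum/=; apply: perm_big.
apply: uniq_perm; [exact: fset_uniq|exact: enum_uniq|].
by move=> i; rewrite JT mem_enum.
Qed.

Lemma bernoulli_prob_true (R : realType) (r : R) : 0 <= r <= 1 ->
  bernoulli_prob r [set true] = r%:E.
Proof. by move=> r01; rewrite /bernoulli_prob r01 fsbig_set1. Qed.

Section minimal_random_walk.
Context d (T : measurableType d) (R : realType) (P : probability T R).
Variables (p q s : R).
Variables (X alpha beta : nat -> {RV P >-> bool}) (U : nat -> {RV P >-> nat}).
Variable S : nat -> T -> R.
Hypotheses (p01 : 0 <= p <= 1) (q01 : 0 <= q <= 1) (s01 : 0 <= s <= 1).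
Hypothesis mrw : minimal_random_walk p q s X alpha beta U S.

Local Notation bmf := bounded_measurable.

Let alphaE n : (1 <= n)%N -> P (alpha n.+1 @^-1` [set true]) = p%:E.
Proof.
move=> n1; rewrite -[LHS]/(distribution P (alpha n.+1) [set true]).
by rewrite (mrw_alpha mrw)// bernoulli_prob_true.
Qed.

Let betaE n : (1 <= n)%N -> P (beta n.+1 @^-1` [set true]) = q%:E.
Proof.
move=> n1; rewrite -[LHS]/(distribution P (beta n.+1) [set true]).
by rewrite (mrw_beta mrw)// bernoulli_prob_true.
Qed.

Let preimage_g (d' : measure_display) (V : measurableType d') (Y : T -> V) B :
  measurable B -> g_sigma_algebra_preimage Y (Y @^-1` B).
Proof. by move=> mB; exists B => //; rewrite setTI. Qed.

Let setT_g (d' : measure_display) (V : measurableType d') (Y : T -> V) :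
  g_sigma_algebra_preimage Y [set: T].
Proof. by exists setT => //; rewrite setTI preimage_setT. Qed.

Let ind_step n k A B E : (1 <= k <= n)%N ->
  g_sigma_algebra_preimage (alpha n.+1) A ->
  g_sigma_algebra_preimage (beta n.+1) B ->
  sigma_upto (fun i => X i : T -> bool) n E ->
  P (A `&` (B `&` (U n @^-1` [set k] `&` E))) =
  (P A * (P B * ((n%:R^-1)%:E * P E)))%E.
Proof.
move=> kn sA sB sE; have n1 : (1 <= n)%N by case/andP: kn => /leq_trans; apply.
have := @mutually_independent_ord _ _ _ _ _ _
  (tnth [tuple A; B; U n @^-1` [set k]; E]) (mrw_independent mrw n1).
rewrite !big_ord_recl big_ord0 /= !(tnth_nth setT)/=.
rewrite (mrw_U mrw kn) mule1 => <-.
  congr (P _); apply/seteqP; split=> [w /= [Aw [Bw [Uw Ew]]] i _|w /= H].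
    by case: i => -[|[|[|[|//]]]] iP; rewrite (tnth_nth setT).
  have H0 := H (@Ordinal 4 0 isT) I; have H1 := H (@Ordinal 4 1 isT) I.
  have H2 := H (@Ordinal 4 2 isT) I.
  by have H3 := H (@Ordinal 4 3 isT) I.
case=> -[|[|[|[|//]]]] iP; rewrite !(tnth_nth setT)/=.
- exact: sA.
- exact: sB.
- exact: preimage_g.
- exact: sE.
Qed.

(** By linearity it suffices to take for [Z] the indicator of an atom of the past. In the
    applications [A] says that one of the two coins shows 1, and [r] is p / n or q / n. *)
Let Rintegral_selected n k (A : set T) r (Z : T -> R) : measurable A ->
  (forall E, sigma_upto (fun i => X i : T -> bool) n E ->
    P (A `&` (U n @^-1` [set k] `&` E)) = (r%:E * P E)%E) ->
  adapted X n Z ->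
  \int[P]_w (\1_A w * \1_(U n @^-1` [set k]) w * Z w) = r * \int[P]_w Z w.
Proof.
move=> mA PA /adapted_sum_indic[f Zf].
have mk : measurable (U n @^-1` [set k]) by exact: measurable_funPTI.
under eq_Rintegral do rewrite Zf mulr_sumr.
under [in RHS]eq_Rintegral do rewrite Zf.
have b1 x : bmf (fun w => f x * \1_[set w | history X n w = x] w).
  apply: bounded_measurableM; first exact: bounded_measurable_cst.
  by apply: bounded_measurable_indic; exact: measurable_history.
rewrite !RintegralT_sum//; last first.
  move=> x; apply: bounded_measurableM => //.
  by apply: bounded_measurableM; exact: bounded_measurable_indic.
rewrite mulr_sumr; apply: eq_bigr => x _.
set Ex := [set w | history X n w = x].
have mE : measurable Ex by exact: measurable_history.
rewrite RintegralZl//; last first.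
  by apply: bounded_measurable_integrable; exact: bounded_measurable_indic.
have -> : (fun w => \1_A w * \1_(U n @^-1` [set k]) w * (f x * \1_Ex w)) =
    (fun w => f x * \1_(A `&` (U n @^-1` [set k] `&` Ex)) w) :> (T -> R).
  by apply/funext => w; rewrite !indicI/=; ring.
have mAE : measurable (A `&` (U n @^-1` [set k] `&` Ex)).
  by apply: measurableI => //; exact: measurableI.
rewrite RintegralZl//; last first.
  by apply: bounded_measurable_integrable; exact: bounded_measurable_indic.
rewrite !RintegralT_indic// PA; last exact: sigma_upto_history.
by rewrite fineM// ?fin_num_measure//= mulrCA.
Qed.

(** [mrw_U] gives mass 1 / n to each of the n disjoint events [U n = k] with k between 1 and n; they
    exhaust the total mass, so other values occur on a null set only. *)
Let U_range n : (1 <= n)%N -> {ae P, forall w, (1 <= U n w <= n)%N}.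
Proof.
move=> n1; pose F k := U n @^-1` [set k.+1].
have mF k : measurable (F k) by exact: measurable_funPTI.
have mFF : measurable (\big[setU/set0]_(k < n) F k).
  by apply: bigsetU_measurable => k _.
have PF : P (\big[setU/set0]_(k < n) F k) = 1%E.
  rewrite measure_semi_additive_ord_I//; last first.
    by apply/trivIsetP => i j _ _ ij; rewrite -subset0 => w [/= Ui];
      rewrite /F/= Ui => -[/eqP]; rewrite (negbTE ij).
  rewrite (eq_bigr (fun=> (n%:R^-1)%:E)); last first.
    by move=> k _; apply: (mrw_U mrw); rewrite /= ltn_ord.
  rewrite sumEFin sumr_const card_ord -[_ *+ _]mulr_natr mulVf//.
  by rewrite pnatr_eq0 -lt0n.
exists (~` \big[setU/set0]_(k < n) F k); split; first exact: measurableC.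
  by rewrite probability_setC// PF subee.
move=> w /= Uw; apply: contra_not Uw; rewrite -bigcup_mkord => -[k /= kn].
by rewrite /F/= => ->; rewrite ltnS leq0n.
Qed.

Lemma mrw_SE n w : S n w = \sum_(i < n) (X i.+1 w)%:R.
Proof.
elim: n => [|n IHn]; first by rewrite (mrw_S0 mrw) big_ord0.
by rewrite (mrw_S mrw) IHn big_ord_recr.
Qed.

Lemma adapted_X n k : (1 <= k <= n)%N -> adapted X n (fun w => (X k w)%:R : R).
Proof. by move=> kn w w' /(_ _ kn) ->. Qed.

Lemma adapted_S n : adapted X n (S n).
Proof.
move=> w w' ww'; rewrite !mrw_SE; apply: eq_bigr => i _.
by rewrite ww'//= ltn_ord.
Qed.

Lemma bounded_measurable_X k : (1 <= k)%N -> bmf (fun w => (X k w)%:R : R).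
Proof.
by move=> k1; apply: (@adapted_bounded_measurable _ _ _ P X k); apply: adapted_X;
  rewrite k1 leqnn.
Qed.

(* Conditional probability that step n+1 is 1, given the first n steps. *)
Definition success_prob (n : nat) (w : T) : R := q + (p - q) * (S n w / n%:R).

Lemma adapted_success_prob n : adapted X n (success_prob n).
Proof. by move=> w w' /adapted_S; rewrite /success_prob => ->. Qed.

Lemma success_prob_itv n w : (1 <= n)%N -> 0 <= success_prob n w <= 1.
Proof.
move=> n1; have n0 : 0 < n%:R :> R by rewrite ltr0n.
have S0 : 0 <= S n w / n%:R.
  by rewrite divr_ge0// mrw_SE sumr_ge0.
have S1 : S n w / n%:R <= 1.
  rewrite ler_pdivrMr// mul1r mrw_SE -[n in leRHS]card_ord -sumr_const ler_sum//.
  by move=> i _; case: (X _ _).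
rewrite /success_prob; move: (S n w / n%:R) S0 S1 p01 q01 => x.
move=> x0 x1 /andP[? ?] /andP[? ?]; apply/andP; split; nra.
Qed.

(** The conditional expectation of the next step, expressed through test variables. Splitting
    according to the index [U n] and to the coin in use, each piece carries a factor p / n or q / n,
    and the sum over k is (p S + q (n - S)) / n with S = [S n]. *)
Lemma Rintegral_next_step n (Z : T -> R) : (1 <= n)%N -> adapted X n Z ->
  \int[P]_w (Z w * (X n.+1 w)%:R) = \int[P]_w (Z w * success_prob n w).
Proof.
move=> n1 aZ; have bZ := adapted_bounded_measurable aZ.
have n0 : n%:R != 0 :> R by rewrite pnatr_eq0 -lt0n.
pose A := alpha n.+1 @^-1` [set true]; pose B := beta n.+1 @^-1` [set true].
pose V k := U n @^-1` [set k.+1].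
have mA : measurable A by exact: measurable_funPTI.
have mB : measurable B by exact: measurable_funPTI.
have mtrue : measurable [set true] by [].
have mV k : measurable (V k) by exact: measurable_funPTI.
pose x k w : R := (X k.+1 w)%:R.
pose ZA k w := \1_A w * \1_(V k) w * (Z w * x k w).
pose ZB k w := \1_B w * \1_(V k) w * (Z w * (1 - x k w)).
have aZX (k : 'I_n) : adapted X n (fun w => Z w * x k w).
  move=> w w' ww'; rewrite (aZ _ _ ww') /x; congr (_ * _ %:R).
  by rewrite ww'//= ltn_ord.
have aZX' (k : 'I_n) : adapted X n (fun w => Z w * (1 - x k w)).
  by move=> w w' ww'; rewrite !mulrBr !mulr1 (aZX _ _ _ ww') (aZ _ _ ww').
have bZA (k : 'I_n) : bmf (ZA k).
  apply: bounded_measurableM; last exact: adapted_bounded_measurable (aZX k).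
  by apply: bounded_measurableM; exact: bounded_measurable_indic.
have bZB (k : 'I_n) : bmf (ZB k).
  apply: bounded_measurableM; last exact: adapted_bounded_measurable (aZX' k).
  by apply: bounded_measurableM; exact: bounded_measurable_indic.
(* The event of [beta] is the whole space here, and that of [alpha] is in [IB]: each piece involves
   a single coin. *)
have IA (k : 'I_n) : \int[P]_w ZA k w = p / n%:R * \int[P]_w (Z w * x k w).
  apply: Rintegral_selected => // E sE.
  have := @ind_step n k.+1 _ _ _ (ltn_ord k) (@preimage_g _ _ (alpha n.+1) [set true] mtrue)
    (setT_g (beta n.+1)) sE.
  by rewrite setTI probability_setT mul1e alphaE// muleA -EFinM.
have IB (k : 'I_n) : \int[P]_w ZB k w = q / n%:R * \int[P]_w (Z w * (1 - x k w)).
  apply: Rintegral_selected => // E sE.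
  have := @ind_step n k.+1 _ _ _ (ltn_ord k) (setT_g (alpha n.+1))
    (@preimage_g _ _ (beta n.+1) [set true] mtrue) sE.
  by rewrite setTI probability_setT mul1e betaE// muleA -EFinM.
have -> : \int[P]_w (Z w * (X n.+1 w)%:R) =
    \int[P]_w (\sum_(k < n) (ZA k w + ZB k w)).
  apply: ae_eq_RintegralT.
  - by apply: bounded_measurableM => //; exact: bounded_measurable_X.
  - by apply: bounded_measurable_sum => k; exact: bounded_measurableD.
  apply: filterS (U_range n1) => w /andP[U1 Un].
  have Un' : ((U n w).-1 < n)%N by rewrite prednK.
  (* Only the summand with [k.+1 = U n w] is nonzero; the shift comes from steps being numbered from
     1. *)
  rewrite (bigD1 (Ordinal Un'))//= [X in _ + X]big1 ?addr0; last first.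
    move=> k /eqP kU; rewrite /ZA /ZB [\1_(V k) w]indicE memNset ?mulr0 ?mul0r ?addr0//.
    by move=> /= Uk; apply: kU; apply: val_inj; rewrite /= Uk.
  rewrite /ZA /ZB /x/= !indicE (_ : (w \in V _) = true); last first.
    by apply: mem_set; rewrite /V/= prednK.
  rewrite prednK// (mrw_step mrw)//.
  have -> : (w \in A) = alpha n.+1 w :> bool.
    by apply/idP/idP => [/set_mem //|aw]; exact: mem_set.
  have -> : (w \in B) = beta n.+1 w :> bool.
    by apply/idP/idP => [/set_mem //|aw]; exact: mem_set.
  by rewrite [true%:R]mulr1n; ring.
rewrite RintegralT_sum; last by move=> k; exact: bounded_measurableD.
under eq_bigr => k _.
  rewrite RintegralD//; [|exact: bounded_measurable_integrable..].
  rewrite IA IB -RintegralZl//; last first.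
    exact/bounded_measurable_integrable/adapted_bounded_measurable/aZX.
  rewrite -RintegralZl//; last first.
    exact/bounded_measurable_integrable/adapted_bounded_measurable/aZX'.
  rewrite -RintegralD//; last first.
    apply: bounded_measurable_integrable; apply: bounded_measurableM.
      exact: bounded_measurable_cst.
    exact/adapted_bounded_measurable/aZX'.
    apply: bounded_measurable_integrable; apply: bounded_measurableM.
      exact: bounded_measurable_cst.
    exact/adapted_bounded_measurable/aZX.
  over.
rewrite -RintegralT_sum; last first.
  move=> k; apply: bounded_measurableD; apply: bounded_measurableM.
  - exact: bounded_measurable_cst.
  - exact/adapted_bounded_measurable/aZX.
  - exact: bounded_measurable_cst.
  - exact/adapted_bounded_measurable/aZX'.
apply: eq_Rintegral => w _.
rewrite big_split/= -!mulr_sumr.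
rewrite /success_prob mrw_SE sumrB sumr_const card_ord -[_ *+ _]mulr_natr.
by field.
Qed.


(** * The martingale *)

Local Notation a := (p - q).
Local Notation b := (q / (1 - a)).
Hypotheses (a_lt1 : a < 1) (a_gt12 : 1 / 2 < a).

Let onema_neq0 : 1 - a != 0. Proof. by rewrite gt_eqF// subr_gt0. Qed.

Let growth_neq0 n : growth a n != 0.
Proof. by rewrite gt_eqF// growth_gt0. Qed.

Let adapted_le m n (V : Type) (Z : T -> V) : (m <= n)%N -> adapted X m Z -> adapted X n Z.
Proof.
move=> mn aZ w w' ww'; apply: aZ => i /andP[i1 im].
by apply: ww'; rewrite i1 (leq_trans im).
Qed.

Let adapted_integrable n (Z : T -> R) : adapted X n Z ->
  P.-integrable [set: T] (EFin \o Z).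
Proof. by move=> /adapted_bounded_measurable/bounded_measurable_integrable. Qed.

Definition mrw_martingale (n : nat) (w : T) : R :=
  (S n w - n%:R * b) / growth a n.
Local Notation M := mrw_martingale.

Lemma adapted_martingale n : adapted X n (M n).
Proof. by move=> w w' /adapted_S; rewrite /M => ->. Qed.

(** The centering solves b = q + a b, so [success_prob n] - b is a times S / n - b with S = [S n].
    The mean of [S n.+1] - (n + 1) b given the past is thus (1 + a / n) (S - n b), and [growth]
    absorbs this factor. *)
Lemma martingale_increment n w : (1 <= n)%N ->
  M n.+1 w - M n w = ((X n.+1 w)%:R - success_prob n w) / growth a n.+1.
Proof.
move=> n1; rewrite /M /success_prob (mrw_S mrw) growthS -(natr1 n).
have n0 : 0 < n%:R :> R by rewrite ltr0n.
have na0 : n%:R + a != 0.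
  by rewrite gt_eqF// addr_gt0//; apply: lt_trans a_gt12; rewrite divr_gt0.
have g0 := growth_neq0 n; have n0' : n%:R != 0 :> R by rewrite gt_eqF.
by field; rewrite n0' na0 g0 onema_neq0.
Qed.

(** The martingale property: testing against every adapted [Z] replaces conditional expectations. *)
Lemma Rintegral_martingale_increment n (Z : T -> R) : (1 <= n)%N ->
  adapted X n Z -> \int[P]_w (Z w * (M n.+1 w - M n w)) = 0.
Proof.
move=> n1 aZ.
have bZ := adapted_bounded_measurable aZ.
have bX : bmf (fun w => Z w * (X n.+1 w)%:R).
  by apply: bounded_measurableM => //; exact: bounded_measurable_X.
have bs : bmf (fun w => Z w * success_prob n w).
  apply: bounded_measurableM => //; apply: adapted_bounded_measurable.
  exact: adapted_success_prob.
transitivity (\int[P]_w ((growth a n.+1)^-1 *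
    (Z w * (X n.+1 w)%:R - Z w * success_prob n w))).
  by apply: eq_Rintegral => w _; rewrite martingale_increment//; ring.
rewrite RintegralZl//; last first.
  apply: bounded_measurable_integrable; apply: bounded_measurableD => //.
  under eq_fun do rewrite -mulN1r.
  by apply: bounded_measurableM => //; exact: bounded_measurable_cst.
rewrite RintegralB//; [|exact: bounded_measurable_integrable..].
by rewrite Rintegral_next_step// subrr mulr0.
Qed.

Let adapted_increment n : adapted X n.+1 (fun w => M n.+1 w - M n w).
Proof.
move=> w w' ww'; rewrite (adapted_martingale ww').
by congr (_ - _); exact: (adapted_le (leqnSn n) (@adapted_martingale n)).
Qed.

(** The cross term is the increment times the adapted variable [2 * (Z w * theta w)], so it
    integrates to 0. The factor [theta] covers both the martingale itself, with value 1, and its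
    frozen version, with an indicator. *)
Lemma Rintegral_square_step n (Z theta : T -> R) : (1 <= n)%N ->
  adapted X n Z -> adapted X n theta ->
  \int[P]_w ((Z w + theta w * (M n.+1 w - M n w)) ^+ 2) =
  \int[P]_w (Z w ^+ 2) + \int[P]_w (theta w ^+ 2 * (M n.+1 w - M n w) ^+ 2).
Proof.
move=> n1 aZ at_.
have aZ' := adapted_le (leqnSn n) aZ; have at' := adapted_le (leqnSn n) at_.
have aI := @adapted_increment n.
transitivity (\int[P]_w ((Z w ^+ 2 + (2 * (Z w * theta w)) * (M n.+1 w - M n w)) +
    (theta w ^+ 2 * (M n.+1 w - M n w) ^+ 2))).
  by apply: eq_Rintegral => w _; ring.
rewrite RintegralD//; first last.
- apply: (@adapted_integrable n.+1) => w w' ww'.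
  by rewrite (aI _ _ ww') (at' _ _ ww').
- apply: (@adapted_integrable n.+1) => w w' ww'.
  by rewrite (aI _ _ ww') (at' _ _ ww') (aZ' _ _ ww').
rewrite RintegralD//; first last.
- apply: (@adapted_integrable n.+1) => w w' ww'.
  by rewrite (aI _ _ ww') (at' _ _ ww') (aZ' _ _ ww').
- apply: (@adapted_integrable n.+1) => w w' ww'.
  by rewrite (aZ' _ _ ww').
rewrite Rintegral_martingale_increment ?addr0// => w w' ww'.
by rewrite (at_ _ _ ww') (aZ _ _ ww').
Qed.

(** * Square estimates and almost sure convergence of the martingale *)

Local Notation tail := (tail_bound a).

(** The step and [success_prob n] both lie between 0 and 1, so their difference has square at most
    1. *)
Lemma martingale_increment_square n w : (1 <= n)%N ->
  (M n.+1 w - M n w) ^+ 2 <= tail n - tail n.+1.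
Proof.
move=> n1; apply: le_trans (tail_bound_step a_gt12 n1).
rewrite martingale_increment// expr_div_n.
rewrite ler_piMl ?invr_ge0 ?exprn_ge0 ?(ltW (growth_gt0 _ _))//.
have /andP[s0 s1] := success_prob_itv w n1.
by case: (X n.+1 w); rewrite ?mulr1n ?mulr0n; nra.
Qed.

Lemma Rintegral_square_step_le n (Z theta : T -> R) : (1 <= n)%N ->
  adapted X n Z -> adapted X n theta -> (forall w, theta w ^+ 2 <= 1) ->
  \int[P]_w ((Z w + theta w * (M n.+1 w - M n w)) ^+ 2) <=
  \int[P]_w (Z w ^+ 2) + (tail n - tail n.+1).
Proof.
move=> n1 aZ at_ t1; rewrite Rintegral_square_step// lerD2l.
rewrite -[leRHS](RintegralT_cst P); apply: le_Rintegral => //.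
- apply: (@adapted_integrable n.+1) => w w' ww'.
  by rewrite (@adapted_increment n _ _ ww') (adapted_le (leqnSn n) at_ ww').
- by apply: bounded_measurable_integrable; exact: bounded_measurable_cst.
- move=> w _; apply: le_trans (martingale_increment_square w n1).
  by rewrite ler_piMl ?sqr_ge0.
Qed.

(** Orthogonality of the increments makes their square bounds add up, and these telescope. *)
Lemma Rintegral_martingaleB m k : (1 <= m)%N ->
  \int[P]_w ((M (m + k) w - M m w) ^+ 2) <= tail m - tail (m + k).
Proof.
move=> m1; elim: k => [|k IHk].
  rewrite addn0 subrr; under eq_Rintegral do rewrite subrr expr0n.
  by rewrite RintegralT_cst.
have aM i : (i <= m + k)%N -> adapted X (m + k) (M i).
  by move=> im; apply: (adapted_le im); exact: adapted_martingale.
rewrite addnS; apply: (@le_trans _ _ (\int[P]_w ((M (m + k) w - M m w) ^+ 2) +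
    (tail (m + k) - tail (m + k).+1))); last first.
  by rewrite (le_trans (lerD IHk (lexx _)))// addrA subrK.
under eq_Rintegral => w _.
  rewrite (_ : M (m + k).+1 w - M m w = (M (m + k) w - M m w) +
    cst 1 w * (M (m + k).+1 w - M (m + k) w)); last by rewrite /=; ring.
  over.
apply: Rintegral_square_step_le.
- by rewrite (leq_trans m1)// leq_addr.
- by move=> w w' ww'; rewrite (aM _ (leqnn _) _ _ ww') (aM _ (leq_addr _ _) _ _ ww').
- by [].
- by move=> w; rewrite expr1n.
Qed.

(* [M (m + k) - M m], frozen once it leaves ]-eps, eps[: its last value already
   tells whether eps was ever reached, so that Chebyshev's inequality for it
   yields Doob's maximal inequality without stopping times. *)
Fixpoint frozen (m : nat) (eps : R) (k : nat) (w : T) : R :=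
  if k is j.+1 then
    frozen m eps j w +
    (`|frozen m eps j w| < eps)%R%:R * (M (m + j).+1 w - M (m + j) w)
  else 0.

Lemma adapted_frozen m eps k : adapted X (m + k) (frozen m eps k).
Proof.
elim: k => [//|k IHk] w w' ww' /=.
have ww'k i : (1 <= i <= m + k)%N -> X i w = X i w'.
  by move=> /andP[i1 im]; apply: ww'; rewrite i1 addnS (leq_trans im).
rewrite (IHk _ _ ww'k); congr (_ + _ * _).
by rewrite addnS in ww'; exact: adapted_increment.
Qed.

(** Same telescoping as for the martingale: freezing only multiplies increments by an adapted
    indicator. *)
Lemma Rintegral_frozen m eps k : (1 <= m)%N ->
  \int[P]_w (frozen m eps k w ^+ 2) <= tail m - tail (m + k).
Proof.
move=> m1; elim: k => [|k IHk] /=.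
  rewrite addn0 subrr; under eq_Rintegral do rewrite expr0n.
  by rewrite RintegralT_cst.
have af := @adapted_frozen m eps k.
rewrite addnS; apply: le_trans (Rintegral_square_step_le _ _ _ _) _.
- by rewrite (leq_trans m1)// leq_addr.
- exact: af.
- by move=> w w' ww'; rewrite (af _ _ ww').
- by move=> w; case: (_ < _); rewrite ?expr1n ?expr0n.
- by rewrite (le_trans (lerD IHk (lexx _)))// addrA subrK.
Qed.

Lemma frozen_ge m eps j k w : (j <= k)%N ->
  eps <= `|frozen m eps j w| -> eps <= `|frozen m eps k w|.
Proof.
move=> jk fj; rewrite -(subnKC jk); elim: (k - j)%N => [|i IHi].
  by rewrite addn0.
by rewrite addnS /= ltNge IHi/= mul0r addr0.
Qed.

Lemma frozen_lt m eps k w : 0 < eps -> `|frozen m eps k w| < eps ->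
  frozen m eps k w = M (m + k) w - M m w.
Proof.
move=> e0; elim: k => [_|k IHk fk]; first by rewrite addn0 subrr.
have [fk'|] := ltP `|frozen m eps k w| eps.
  by rewrite /= fk' mul1r (IHk fk') addnS; ring.
by move=> /(frozen_ge (leqnSn k)); rewrite leNgt fk.
Qed.


Let measurable_frozen_ge m eps k :
  measurable [set w | (eps <= `|frozen m eps k w|)%R].
Proof.
have [mf _] := adapted_bounded_measurable (@adapted_frozen m eps k).
rewrite -[X in measurable X]setTI; apply: measurable_fun_le => //.
exact: measurableT_comp.
Qed.

(** Chebyshev's inequality. The bound does not depend on [k], so it survives the union over [k]. *)
Lemma probability_frozen_ge m eps k : (1 <= m)%N -> 0 < eps ->
  (P [set w | (eps <= `|frozen m eps k w|)%R] <= (tail m / eps ^+ 2)%:E)%E.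
Proof.
move=> m1 e0; set A := [set w | _].
have af := @adapted_frozen m eps k.
have bf := adapted_bounded_measurable af.
have mA : measurable A by exact: measurable_frozen_ge.
rewrite -(fineK (fin_num_measure P _ mA)) lee_fin.
rewrite ler_pdivlMr ?exprn_gt0// -RintegralT_indic// -RintegralZr//; last first.
  by apply: bounded_measurable_integrable; exact: bounded_measurable_indic.
apply: (@le_trans _ _ (\int[P]_w (frozen m eps k w ^+ 2))); last first.
  rewrite (le_trans (Rintegral_frozen _ _ m1))// gerBl.
  exact: tail_bound_ge0.
apply: le_Rintegral => //.
- apply: bounded_measurable_integrable; apply: bounded_measurableM.
    exact: bounded_measurable_indic.
  exact: bounded_measurable_cst.
- by apply: (@adapted_integrable (m + k)) => w w' ww'; rewrite (af _ _ ww').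
move=> w _; rewrite indicE; case: (boolP (w \in A)) => [/set_mem wA|_].
  by rewrite mul1r -[leRHS]real_normK ?num_real// lerXn2r// ?nnegrE// ltW.
by rewrite mul0r sqr_ge0.
Qed.

(** The exceptional set is that of exits from every starting time. For a fixed start the exit events
    increase with [k], so their union obeys the Chebyshev bound, which tends to 0 with the start. *)
Lemma ae_martingale_cauchy eps : 0 < eps ->
  {ae P, forall w, exists m, forall k, `|M (m + k) w - M m w| < eps}.
Proof.
move=> e0.
(* The start is [m.+1] because the square estimates hold from time 1 on. *)
pose A m k := [set w | eps <= `|frozen m.+1 eps k w|].
have mA m k : measurable (A m k) by exact: measurable_frozen_ge.
have PA m : (P (\bigcup_k A m k) <= (tail m.+1 / eps ^+ 2)%:E)%E.
  have cA : P (A m k) @[k --> \oo] --> P (\bigcup_k A m k).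
    apply: nondecreasing_cvg_mu => //; first exact: bigcup_measurable.
    by apply/nondecreasing_seqP => k; apply/subsetPset => w; exact: frozen_ge.
  rewrite -(cvg_lim _ cA)//; apply: lime_le; first by apply/cvg_ex; eexists; exact: cA.
  by apply: nearW => k; exact: probability_frozen_ge.
pose N := \bigcap_m \bigcup_k A m k.
have mN : measurable N.
  by apply: bigcapT_measurable => m; exact: bigcup_measurable.
exists N; split => //.
  apply/eqP; rewrite eq_le measure_ge0 andbT.
  rewrite -(fineK (fin_num_measure P _ mN)) lee_fin.
  have : (fun m => tail m.+1 / eps ^+ 2) @ \oo --> (0 : R).
    rewrite -[X in _ --> X](mul0r (eps ^+ 2)^-1); apply: cvgMr_tmp.
    have := cvg_tail_bound a_gt12 a_lt1; by rewrite -cvg_shiftS.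
  move=> c0; rewrite -(cvg_lim _ c0)//; apply: limr_ge.
    by apply/cvg_ex; eexists; exact: c0.
  apply: nearW => m; rewrite -lee_fin fineK ?fin_num_measure//.
  apply: le_trans (PA m); apply: le_measure; rewrite ?inE//.
    exact: bigcup_measurable.
  exact: bigcap_inf.
move=> w /= Mw m _; apply: contra_notP Mw => Am.
exists m.+1 => k; have : ~ A m k w by move=> Amk; apply: Am; exists k.
rewrite /A/= => /negP; rewrite -ltNge => fk.
by rewrite -(frozen_lt e0 fk).
Qed.

Lemma ae_martingale_cvg : {ae P, forall w, cvgn (M ^~ w)}.
Proof.
(* Countably many accuracies suffice, which keeps the exceptional set null. *)
have H : {ae P, forall w, forall i : nat, exists m, forall k,
    `|M (m + k) w - M m w| < i.+1%:R^-1}.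
  by apply/ae_foralln => i; apply: ae_martingale_cauchy; rewrite invr_gt0.
apply: filterS H => w Hw; apply/cauchy_cvgP/cauchy_exP => e e0.
have [i ie] : exists i : nat, i.+1%:R^-1 < e.
  exists (Num.truncn e^-1); rewrite invf_plt ?posrE//; exact: truncnS_gt.
have [m Hm] := Hw i; exists (M m w), m => // n /= mn.
rewrite /ball/= distrC; apply: lt_trans ie.
by have := Hm (n - m)%N; rewrite subnKC.
Qed.


(** * The limit *)

Definition rescaled_mrw (n : nat) (w : T) : R :=
  n%:R `^ (1 - a) * (S n w / n%:R - b).
Local Notation Y := rescaled_mrw.
Local Notation r := (growth_ratio a).

Lemma rescaled_mrwE n w : (1 <= n)%N -> Y n w = r n * M n w.
Proof.
move=> n1; have n0 : 0 < n%:R :> R by rewrite ltr0n.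
rewrite /Y /growth_ratio /M (@powRB _ _ 1 a) ?(gt_eqF n0) ?implybT// powRr1 ?(ltW n0)//.
have na0 : n%:R `^ a != 0 by rewrite gt_eqF// powR_gt0.
field; rewrite na0 (gt_eqF n0) growth_neq0 onema_neq0//.
Qed.

(** An upper limit is measurable on the whole space, unlike a limit known to exist only almost
    surely; [fine] yields 0 where it is infinite. *)
Definition mrw_limit (w : T) : R := fine (limn_esup (fun n => (Y n w)%:E)).
Local Notation L := mrw_limit.

Lemma adapted_rescaled n : adapted X n (Y n).
Proof. by move=> w w' /adapted_S; rewrite /Y => ->. Qed.

Let measurable_rescaled n : measurable_fun [set: T] (Y n).
Proof. by have [] := adapted_bounded_measurable (@adapted_rescaled n). Qed.

Lemma measurable_mrw_limit : measurable_fun [set: T] L.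
Proof.
apply: measurableT_comp => //; apply: measurable_fun_limn_esup => n.
exact/measurable_EFinP.
Qed.

Lemma ae_rescaled_cvg : {ae P, forall w, Y n w @[n --> \oo] --> L w}.
Proof.
apply: filterS ae_martingale_cvg => w /cvg_ex[l Ml].
have Yl : Y n w @[n --> \oo] --> limn r * l.
  have : r n * M n w @[n --> \oo] --> limn r * l.
    by apply: cvgM => //; exact: is_cvg_growth_ratio.
  apply: cvg_trans; apply: near_eq_cvg.
  by exists 1%N => // n /= n1; rewrite rescaled_mrwE.
rewrite /L; have EYl : (Y n w)%:E @[n --> \oo] --> (limn r * l)%:E.
  by apply: cvg_EFin => //; exact: nearW.
by have [_ ->] := cvg_limn_einf_sup EYl.
Qed.

(** * Mean-square convergence to the limit *)

Let B : R := 2 * tail 1 + 2 * \int[P]_w (M 1 w ^+ 2).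

Let adapted_martingale_le m n : (m <= n)%N -> adapted X n (M m).
Proof. by move=> mn; apply: (adapted_le mn); exact: adapted_martingale. Qed.

(** From x^2 <= 2 ((x - y)^2 + y^2), where y is the value at time 1. *)
Lemma Rintegral_martingale_square_le n : (1 <= n)%N ->
  \int[P]_w (M n w ^+ 2) <= B.
Proof.
case: n => // n _; rewrite -add1n.
have aM m : (m <= 1 + n)%N -> adapted X (1 + n) (M m) by exact: adapted_martingale_le.
have i1 : P.-integrable [set: T] (EFin \o (fun w => (M (1 + n) w - M 1 w) ^+ 2)).
  apply: (@adapted_integrable (1 + n)) => w w' ww'.
  by rewrite (aM _ (leqnn _) _ _ ww') (aM _ (leq_addr _ _) _ _ ww').
have i2 : P.-integrable [set: T] (EFin \o (fun w => M 1 w ^+ 2)).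
  apply: (@adapted_integrable (1 + n)) => w w' ww'.
  by rewrite (aM _ (leq_addr _ _) _ _ ww').
apply: (@le_trans _ _
    (\int[P]_w (2 * ((M (1 + n) w - M 1 w) ^+ 2 + M 1 w ^+ 2)))).
  apply: le_Rintegral => //.
  - apply: (@adapted_integrable (1 + n)) => w w' ww'.
    by rewrite (aM _ (leqnn _) _ _ ww').
  - apply: (@adapted_integrable (1 + n)) => w w' ww'.
    by rewrite (aM _ (leqnn _) _ _ ww') (aM _ (leq_addr _ _) _ _ ww').
  move=> w _; rewrite -subr_ge0.
  have -> : 2 * ((M (1 + n) w - M 1 w) ^+ 2 + M 1 w ^+ 2) - M (1 + n) w ^+ 2 =
    (M (1 + n) w - 2 * M 1 w) ^+ 2 by ring.
  exact: sqr_ge0.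
rewrite RintegralZl//; last first.
  apply: (@adapted_integrable (1 + n)) => w w' ww'.
  by rewrite (aM _ (leqnn _) _ _ ww') (aM _ (leq_addr _ _) _ _ ww').
rewrite RintegralD// /B -mulrDr ler_wpM2l// lerD2r.
rewrite (le_trans (Rintegral_martingaleB n (leqnn 1)))// gerBl.
exact: tail_bound_ge0.
Qed.

(** Comes from splitting [Y m - Y n] as [r m * (M m - M n) + (r m - r n) * M n]: the constant 8 is 2
    times the square of the bound [r m <= 2], and [r m] is replaced by its limit in the second term,
    so that [m] disappears. *)
Let rate n : R := 8 * tail n + 2 * (limn r - r n) ^+ 2 * B.

Let cvg_rate : rate n @[n --> \oo] --> 0.
Proof.
rewrite (_ : 0 = 8 * 0 + 2 * (limn r - limn r) ^+ 2 * B); last first.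
  by rewrite subrr expr0n/= !mulr0 mul0r addr0.
apply: cvgD; first by apply: cvgMl_tmp; exact: cvg_tail_bound.
apply: cvgMr_tmp; apply: cvgMl_tmp; rewrite expr2; under eq_fun do rewrite expr2.
have rr : limn r - r n @[n --> \oo] --> limn r - limn r.
  by apply: cvgB; [exact: cvg_cst|exact: is_cvg_growth_ratio].
exact: cvgM.
Qed.

Lemma Rintegral_rescaledB m n : (1 <= n)%N -> (n <= m)%N ->
  \int[P]_w ((Y n w - Y m w) ^+ 2) <= rate n.
Proof.
move=> n1 nm; have m1 := leq_trans n1 nm.
have aMm : adapted X m (M m) by exact: adapted_martingale.
have aMn : adapted X m (M n) by exact: adapted_martingale_le.
have i1 : P.-integrable [set: T] (EFin \o (fun w => (M m w - M n w) ^+ 2)).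
  by apply: (@adapted_integrable m) => w w' ww'; rewrite (aMm _ _ ww') (aMn _ _ ww').
have i2 : P.-integrable [set: T] (EFin \o (fun w => M n w ^+ 2)).
  by apply: (@adapted_integrable m) => w w' ww'; rewrite (aMn _ _ ww').
have i3 : P.-integrable [set: T] (EFin \o (fun w => 8 * (M m w - M n w) ^+ 2)).
  by apply: (@adapted_integrable m) => w w' ww'; rewrite (aMm _ _ ww') (aMn _ _ ww').
have i4 : P.-integrable [set: T]
    (EFin \o (fun w => 2 * (limn r - r n) ^+ 2 * M n w ^+ 2)).
  by apply: (@adapted_integrable m) => w w' ww'; rewrite (aMn _ _ ww').
apply: (@le_trans _ _ (\int[P]_w (8 * (M m w - M n w) ^+ 2 +
    2 * (limn r - r n) ^+ 2 * M n w ^+ 2))).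
  apply: le_Rintegral => //.
  - apply: (@adapted_integrable m) => w w' ww'.
    by rewrite !rescaled_mrwE// (aMm _ _ ww') (aMn _ _ ww').
  - apply: (@adapted_integrable m) => w w' ww'.
    by rewrite (aMm _ _ ww') (aMn _ _ ww').
  move=> w _; rewrite !rescaled_mrwE//.
  have rm2 := growth_ratio_le2 a_gt12 a_lt1 m1.
  have rm0 : 0 <= r m by rewrite (le_trans _ (growth_ratio_ge1 a_gt12 a_lt1 m1)).
  have rnm := growth_ratio_le a_gt12 a_lt1 n1 nm.
  have rmc := growth_ratio_le_lim a_gt12 a_lt1 m1.
  (* The bound (u + v)^2 <= 2 u^2 + 2 v^2 for that splitting; the defect is (u - v)^2. *)
  apply: (@le_trans _ _ (2 * r m ^+ 2 * (M m w - M n w) ^+ 2 +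
      2 * (r m - r n) ^+ 2 * M n w ^+ 2)).
    rewrite -subr_ge0 (_ : _ - _ =
      (r m * (M m w - M n w) - (r m - r n) * M n w) ^+ 2); last by ring.
    exact: sqr_ge0.
  apply: lerD; rewrite ler_wpM2r ?sqr_ge0//.
    by nra.
  rewrite ler_wpM2l// lerXn2r ?nnegrE ?subr_ge0// ?(le_trans rnm)//.
  by rewrite lerD2r.
rewrite RintegralD// !RintegralZl// lerD// ler_wpM2l//.
- rewrite -(subnKC nm); apply: le_trans (Rintegral_martingaleB _ n1) _.
  by rewrite gerBl tail_bound_ge0.
- by rewrite mulr_ge0// sqr_ge0.
- exact: Rintegral_martingale_square_le.
Qed.

Let measurable_sqrB (f g : T -> R) : measurable_fun [set: T] f ->
  measurable_fun [set: T] g ->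
  measurable_fun [set: T] (fun w => ((f w - g w) ^+ 2)%:E).
Proof.
move=> mf mg; apply/measurable_EFinP.
by apply: measurable_funX; exact: measurable_funB.
Qed.

(** Fatou's lemma in m with n fixed: almost sure convergence identifies the lower limit of the
    integrands, and [Rintegral_rescaledB] bounds the integrals for all m >= n. *)
Lemma integral_rescaledB_le n : (1 <= n)%N ->
  (\int[P]_w ((Y n w - L w) ^+ 2)%:E <= (rate n)%:E)%E.
Proof.
move=> n1.
have mY m : measurable_fun [set: T] (fun w => ((Y n w - Y m w) ^+ 2)%:E).
  exact: measurable_sqrB.
rewrite (@ae_eq_integral _ _ _ P _
  (fun w => limn_einf (fun m => ((Y n w - Y m w) ^+ 2)%:E)))//.
- apply: (@le_trans _ _ _ _ _ (fatou P measurableT mY _)).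
    by move=> m w _; rewrite lee_fin sqr_ge0.
  apply: (@limn_einf_le _ _ n) => m nm.
  rewrite -[leLHS]fineK ?lee_fin; first exact: Rintegral_rescaledB.
  apply: integrable_fin_num => //.
  have -> : (fun w => ((Y n w - Y m w) ^+ 2)%:E) =
    EFin \o (fun w => (Y n w - Y m w) ^+ 2) by [].
  apply: (@adapted_integrable m) => w w' ww'.
  by rewrite (adapted_le nm (@adapted_rescaled n) ww') (adapted_rescaled ww').
- exact: measurable_sqrB measurable_mrw_limit.
- rewrite /limn_einf; apply: measurableT_comp => //.
  apply: measurable_fun_limn_esup => m.
  exact: measurableT_comp.
- apply: filterS ae_rescaled_cvg => w YL _.
  have c : ((Y n w - Y m w) ^+ 2)%:E @[m --> \oo] --> ((Y n w - L w) ^+ 2)%:E.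
    apply: cvg_EFin; first exact: nearW.
    rewrite expr2; under eq_fun do rewrite expr2.
    have YnL : Y n w - Y m w @[m --> \oo] --> Y n w - L w.
      by apply: cvgB => //; exact: cvg_cst.
    exact: cvgM.
  by have [-> _] := cvg_limn_einf_sup c.
Qed.

Lemma cvg_rescaled_L2 :
  (\int[P]_w ((Y n w - L w) ^+ 2)%:E)%E @[n --> \oo] --> 0%E.
Proof.
have c : (rate n)%:E @[n --> \oo] --> 0%E.
  by apply: cvg_EFin; [exact: nearW|exact: cvg_rate].
apply: squeeze_cvge (cvg_cst 0%E) c.
exists 1%N => // n /= n1; rewrite integral_rescaledB_le// andbT.
by apply: integral_ge0 => w _; rewrite lee_fin sqr_ge0.
Qed.

(** * Non-degeneracy of the limit *)

Lemma Rintegral_X1 : \int[P]_w (X 1 w)%:R = s.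
Proof.
have mX : measurable (X 1%N @^-1` [set true]) by exact: measurable_funPTI.
transitivity (\int[P]_w (\1_(X 1%N @^-1` [set true]) w : R)).
  apply: eq_Rintegral => w _; rewrite indicE (_ : (w \in _) = X 1%N w)//.
  by apply/idP/idP => [/set_mem//|Xw]; exact: mem_set.
rewrite RintegralT_indic// -[P _]/(distribution P (X 1%N) [set true]).
by rewrite (mrw_X1 mrw) bernoulli_prob_true.
Qed.

Let adapted_X1 : adapted X 1 (fun w => (X 1 w)%:R : R).
Proof. exact: adapted_X. Qed.

Let S1E w : S 1%N w = (X 1%N w)%:R.
Proof. by rewrite mrw_SE big_ord1. Qed.

Lemma Rintegral_first_square x :
  \int[P]_w ((M 1 w - x) ^+ 2) = s * (1 - s) + (s - b - x) ^+ 2.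
Proof.
(* A 0/1-valued variable equals its square, so the integrand is affine in [X 1]. *)
transitivity (\int[P]_w ((1 - 2 * (b + x)) * (X 1%N w)%:R + (b + x) ^+ 2)).
  apply: eq_Rintegral => w _; rewrite /M S1E growth1 divr1 mul1r.
  by case: (X 1%N w); rewrite ?mulr1n ?mulr0n; ring.
rewrite RintegralD//; last 2 first.
- by apply: (@adapted_integrable 1) => w w' ww'; rewrite (adapted_X1 ww').
- by apply: bounded_measurable_integrable; exact: bounded_measurable_cst.
rewrite RintegralZl//; last exact: adapted_integrable adapted_X1.
by rewrite RintegralT_cst Rintegral_X1; ring.
Qed.

(** The mean conditional variance of the second step: given the first step it is Bernoulli with
    parameter [p] after a 1 and [q] after a 0. *)
Let V : R := s * (p * (1 - p)) + (1 - s) * (q * (1 - q)).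

Lemma Rintegral_first_increment :
  \int[P]_w ((M 2 w - M 1 w) ^+ 2) = V / growth a 2 ^+ 2.
Proof.
have a1 := @adapted_success_prob 1.
transitivity (\int[P]_w ((growth a 2 ^+ 2)^-1 *
    ((1 - 2 * success_prob 1 w) * (X 2 w)%:R + success_prob 1 w ^+ 2))).
  apply: eq_Rintegral => w _; rewrite martingale_increment// expr_div_n mulrC.
  congr (_ * _).
  by case: (X 2 w); rewrite ?mulr1n ?mulr0n; ring.
have az : adapted X 1 (fun w => 1 - 2 * success_prob 1 w).
  by move=> w w' ww'; rewrite (a1 _ _ ww').
have iz : P.-integrable [set: T]
    (EFin \o (fun w => (1 - 2 * success_prob 1 w) * (X 2 w)%:R)).
  apply: bounded_measurable_integrable; apply: bounded_measurableM.
    exact: adapted_bounded_measurable az.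
  exact: bounded_measurable_X.
have is2 : P.-integrable [set: T] (EFin \o (fun w => success_prob 1 w ^+ 2)).
  by apply: (@adapted_integrable 1) => w w' ww'; rewrite (a1 _ _ ww').
rewrite RintegralZl//; last first.
  have := @bounded_measurable_integrable _ _ _ P; apply.
  apply: bounded_measurableD.
    apply: bounded_measurableM; last exact: bounded_measurable_X.
    exact: adapted_bounded_measurable az.
  apply: (@adapted_bounded_measurable _ _ _ P X 1) => w w' ww'.
  by rewrite (a1 _ _ ww').
rewrite mulrC; congr (_ / _).
rewrite RintegralD// Rintegral_next_step// -RintegralD//; last first.
  by apply: (@adapted_integrable 1) => w w' ww'; rewrite (a1 _ _ ww').
(* What remains is [success_prob 1] times its complement to 1, where [success_prob 1] is [p] or [q]
   according to [X 1]. *)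
transitivity (\int[P]_w ((p * (1 - p) - q * (1 - q)) * (X 1%N w)%:R + q * (1 - q))).
  apply: eq_Rintegral => w _; rewrite /success_prob S1E divr1.
  by case: (X 1%N w); rewrite ?mulr1n ?mulr0n; ring.
rewrite RintegralD//; last 2 first.
- by apply: (@adapted_integrable 1) => w w' ww'; rewrite (adapted_X1 ww').
- by apply: bounded_measurable_integrable; exact: bounded_measurable_cst.
rewrite RintegralZl//; last exact: adapted_integrable adapted_X1.
by rewrite RintegralT_cst Rintegral_X1 /V; ring.
Qed.

(** Orthogonality makes the mean square distance to any constant nondecreasing in time, so time 2
    gives the bound. The constant is arbitrary because [c / r n], used later, varies with n. *)
Lemma Rintegral_martingale_square_ge n x : (2 <= n)%N ->
  s * (1 - s) + V / growth a 2 ^+ 2 <= \int[P]_w ((M n w - x) ^+ 2).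
Proof.
have step k : (1 <= k)%N -> \int[P]_w ((M k.+1 w - x) ^+ 2) =
    \int[P]_w ((M k w - x) ^+ 2) + \int[P]_w ((M k.+1 w - M k w) ^+ 2).
  move=> k1.
  transitivity (\int[P]_w (((M k w - x) + cst 1 w * (M k.+1 w - M k w)) ^+ 2)).
    by apply: eq_Rintegral => w _ /=; ring.
  rewrite Rintegral_square_step//; last first.
    by move=> w w' ww'; rewrite (adapted_martingale ww').
  by congr (_ + _); apply: eq_Rintegral => w _; rewrite /= expr1n mul1r.
move=> n2; rewrite -(subnKC n2); elim: (n - 2)%N => [|k IHk].
  rewrite addn0 step// Rintegral_first_square Rintegral_first_increment.
  by rewrite lerD2r lerDl sqr_ge0.
rewrite addnS step ?addn_gt0//; apply: (le_trans IHk); rewrite lerDl.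
by apply: Rintegral_ge0 => w _; rewrite sqr_ge0.
Qed.

(** If the limit were a constant [c], then since [r n >= 1] the mean square of [Y n - c] would
    dominate that of [M n - c / r n], hence stay above [K > 0], against mean-square convergence. *)
Lemma mrw_limit_nondegenerate : ~ (s = 0 /\ q = 0) -> ~ (s = 1 /\ p = 1) ->
  nondegenerate_RV P L.
Proof.
move=> sq sp [c Lc].
pose K := s * (1 - s) + V / growth a 2 ^+ 2.
have K0 : 0 < K.
  have g2 : 0 < (growth a 2 ^+ 2)^-1.
    by rewrite invr_gt0 exprn_gt0// growth_gt0.
  have /andP[p0 p1] := p01; have /andP[q0 q1] := q01; have /andP[s0 s1] := s01.
  (* For 0 < s < 1 the first step is already random. For s = 0 the second step has variance q (1 -
     q), with q < 1 forced by a > 1/2; for s = 1 it has variance p (1 - p), with p > 0 for the same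
     reason. *)
  rewrite /K /V; have [sE|s_neq0] := eqVneq s 0.
    have q_neq0 : q != 0 by apply/eqP => qE; apply: sq.
    have q_gt0 : 0 < q by rewrite lt_neqAle eq_sym q_neq0.
    have q_lt1 : q < 1 by move: a_gt12 p1; lra.
    rewrite sE !mul0r !add0r subr0 mul1r mulr_gt0// mulr_gt0// subr_gt0//.
  have [sE|s_neq1] := eqVneq s 1.
    have p_neq1 : p != 1 by apply/eqP => pE; apply: sp.
    have p_lt1 : p < 1 by rewrite lt_neqAle p_neq1.
    have p_gt0 : 0 < p by move: a_gt12 q0; lra.
    rewrite sE subrr mulr0 mul0r add0r addr0 mul1r mulr_gt0// mulr_gt0// subr_gt0//.
  have s_gt0 : 0 < s by rewrite lt_neqAle eq_sym s_neq0.
  have s_lt1 : s < 1 by rewrite lt_neqAle s_neq1.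
  rewrite ltr_pwDl ?mulr_gt0 ?subr_gt0// mulr_ge0 ?(ltW g2)//.
  by rewrite addr_ge0 ?mulr_ge0 ?subr_ge0.
have Kle n : (2 <= n)%N -> (K%:E <= \int[P]_w ((Y n w - L w) ^+ 2)%:E)%E.
  move=> n2; have n1 := ltnW n2.
  have rn1 := growth_ratio_ge1 a_gt12 a_lt1 n1.
  have rn0 : 0 < r n by exact: lt_le_trans rn1.
  rewrite (@ae_eq_integral _ _ _ P _ (fun w => ((Y n w - c) ^+ 2)%:E))//; last first.
  - by apply: filterS Lc => w -> .
  - exact: measurable_sqrB.
  - exact: measurable_sqrB measurable_mrw_limit.
  have iY : P.-integrable [set: T] (EFin \o (fun w => (Y n w - c) ^+ 2)).
    by apply: (@adapted_integrable n) => w w' ww'; rewrite (adapted_rescaled ww').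
  rewrite -[leRHS]fineK; last exact: integrable_fin_num iY.
  rewrite lee_fin; apply: le_trans (Rintegral_martingale_square_ge (c / r n) n2) _.
  apply: le_Rintegral => //.
    by apply: (@adapted_integrable n) => w w' ww'; rewrite (adapted_martingale ww').
  move=> w _; rewrite rescaled_mrwE//.
  have -> : r n * M n w - c = r n * (M n w - c / r n).
    by field; rewrite gt_eqF.
  by rewrite exprMn ler_peMl ?sqr_ge0// exprn_ege1.
have : (K%:E <= 0)%E.
  rewrite -(cvg_lim _ cvg_rescaled_L2)//; apply: lime_ge.
    by apply/cvg_ex; eexists; exact: cvg_rescaled_L2.
  by exists 2%N.
by rewrite lee_fin leNgt K0.
Qed.

End minimal_random_walk.

Theorem theorem2p5 (R : realType) (d : measure_display) (T : measurableType d)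
    (P : probability T R) (p q s : R)
    (X alpha beta : nat -> {RV P >-> bool}) (U : nat -> {RV P >-> nat})
    (S : nat -> T -> R)
    (hp : 0 <= p <= 1) (hq : 0 <= q <= 1) (hs : 0 <= s <= 1)
    (hS : minimal_random_walk p q s X alpha beta U S) :
  let a := p - q in
  a < 1 -> 1 / 2 < a ->
  exists L : {RV P >-> R},
    [/\ (* if s = q = 0 or s = p = 1 then S is a.s. deterministic and L = 0 *)
        ~ (s = 0 /\ q = 0) -> ~ (s = 1 /\ p = 1) -> nondegenerate_RV P L,
        {ae P, forall w,
          {family compactly_in (`]0, +oo[ : set R),
            (fun (n : nat) (t : R) =>
               n%:R `^ (1 - a)
               * (S (Num.truncn (n%:R * t)) w / (Num.truncn (n%:R * t))%:R
                  - q / (1 - a)))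
            @ \oo --> (fun t : R => 1 / t `^ (1 - a) * L w)}},
        {ae P, forall w,
          (n%:R `^ (1 - a) * (S n w / n%:R - q / (1 - a))) @[n --> \oo]
            --> L w}
      & 'E_P[fun w => ((n%:R `^ (1 - a) * (S n w / n%:R - q / (1 - a)) - L w)
                        ^+ 2)%R]%E @[n --> \oo] --> 0%E].
Proof.
move=> a a_lt1 a_gt12.
have mL := measurable_mrw_limit hS.
pose Lm := isMeasurableFun.Build _ _ T R (mrw_limit p q S) mL.
pose L : {RV P >-> R} := HB.pack (mrw_limit p q S) Lm.
have YL := ae_rescaled_cvg hp hq hS a_lt1 a_gt12.
exists L; split.
- exact: mrw_limit_nondegenerate hp hq hs hS a_lt1 a_gt12.
- apply: filterS YL => w YLw.
  apply: (@family_cvg_rescale _ (1 - a) (S^~ w)) => //.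
  rewrite subr_ge0 (ltW a_lt1)/= gerBl.
  by apply: ltW; apply: lt_trans a_gt12; rewrite divr_gt0.
- exact: YL.
- under eq_fun do rewrite unlock.
  exact: (cvg_rescaled_L2 hp hq hS a_lt1 a_gt12).
Qed.
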